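(* Let $a,b$ be relatively prime positive integers and let $P$ be an $(a,b)$-Dyck path. Create a grid with $a$ rows and $b$ columns. Label the rows of the grid by the north intervals of $P$, increasing from bottom to top, and the columns of the grid by the east intervals of $P$, increasing from left to right. Shade a box of the grid when the corresponding row and column intervals do not intersect. Then the boundary path of the shaded boxes above the main diagonal is $\zeta(P)$, and the boundary path of the shaded boxes below the main diagonal is $\eta(P)$ rotated by $180^\circ$. (That is, the shaded boxes above the main diagonal are exactly the boxes northwest of $\zeta(P)$, and the shaded boxes below the main diagonal are exactly the boxes southeast of the $180^\circ$-rotation of $\eta(P)$.)
   Context: An $(a,b)$-Dyck path is a lattice path from $(0,0)$ to $(b,a)$ with unit north steps and unit east steps, all of whose lattice points $(x,y)$ satisfy $ax\le by$; it is drawn in the grid with $a$ rows and $b$ columns. The main diagonal is the segment from $(0,0)$ to $(b,a)$. Levels and intervals: the level of the lattice point $(x,y)$ is $by-ax$. The north levels $\mathsf{N}(P)=\{n_1,\dots,n_a\}$ are the levels of the initial (southern) lattice points of the north steps of $P$; the east levels $\mathsf{E}(P)=\{e_1,\dots,e_b\}$ are the levels of the initial (western) lattice points of the east steps of $P$. The north intervals of $P$ are the closed intervals $[n_i,n_i+b]$, $n_i\in\mathsf{N}(P)$; the east intervals of $P$ are the closed intervals $[e_j-a,e_j]$, $e_j\in\mathsf{E}(P)$. Hooks and cores: the unit box with southeast corner $(x,y)$ has hook filling $by-ax$. The positive hooks of $P$ are the positive hook fillings of the boxes of the grid lying below (southeast of) $P$. $\mathfrak{c}(P)$ is the partition whose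 set of first-column hook lengths is the set of positive hooks of $P$ (it is an $(a,b)$-core, i.e. has no hook length equal to $a$ or $b$). For a partition $\kappa$ and a positive integer $m$: consider the hook lengths of the boxes in the first column of $\kappa$; for each residue modulo $m$ that occurs take the largest such hook length; the rows of $\kappa$ with these first-column hook lengths are the $m$-rows. The $m$-boundary of $\kappa$ is the set of boxes with hook length less than $m$. Zeta and eta: the partition bounded by a path is the partition whose Young diagram (English notation) is the set of boxes of the grid above (northwest of) the path. $\lambda(P)=(\lambda_1\ge\dots\ge\lambda_a)$ has as parts the numbers of $b$-boundary boxes in the $a$-rows of $\mathfrak{c}(P)$ (padded with zeros), and $\mu(P)=(\mu_1\ge\dots\ge\mu_b)$ has as parts the numbers of $a$-boundary boxes in the $b$-rows of $\mathfrak{c}(P)$ (padded with zeros). $\zeta(P)$ is the $(a,b)$-Dyck path bounding $\lambda(P)$, and $\eta(P)$ is the $(a,b)$-Dyck path bounding the conjugate partition of $\mu(P)$. *)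

(* Defs.v *)
From mathcomp Require Import all_boot all_order all_algebra.
From mathcomp Require Import zify.

Set Implicit Arguments.
Unset Strict Implicit.
Unset Printing Implicit Defensive.

Import Order.TTheory GRing.Theory Num.Theory.

(* A lattice path starting at (0,0) is its sequence of steps: true is a unit
   north step, false a unit east step.  (ptx Q k, pty Q k) is the lattice point
   reached after k steps. *)
Definition ptx (Q : seq bool) (k : nat) : nat := count negb (take k Q).
Definition pty (Q : seq bool) (k : nat) : nat := count id (take k Q).

Definition lattice_path (a b : nat) (Q : seq bool) : bool :=
  (count id Q == a) && (count negb Q == b).

Definition dyck_path (a b : nat) (Q : seq bool) : bool :=
  lattice_path a b Q &&
  all (fun k => a * ptx Q k <= b * pty Q k) (iota 0 (size Q).+1).

Definition level (a b x y : nat) : int := ((b * y)%N%:Z - (a * x)%N%:Z)%R.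

Definition north_levels (a b : nat) (P : seq bool) : seq int :=
  [seq level a b (ptx P k) (pty P k) | k <- iota 0 (size P) & nth false P k].

Definition east_levels (a b : nat) (P : seq bool) : seq int :=
  [seq level a b (ptx P k) (pty P k) | k <- iota 0 (size P) & ~~ nth false P k].

(* A unit box is named (c, r), the coordinates of its southwest corner:
   c is the column counted from the left, r the row counted from the bottom. *)
Definition boxes (a b : nat) : seq (nat * nat) :=
  [seq (c, r) | c <- iota 0 b, r <- iota 0 a].

(* The box is northwest (resp. southeast) of Q when some lattice point of Q is
   weakly southeast (resp. northwest) of its southeast (resp. northwest)
   corner. *)
Definition northwest_of (Q : seq bool) (c r : nat) : bool :=
  has (fun k => (c.+1 <= ptx Q k) && (pty Q k <= r)) (iota 0 (size Q).+1).

Definition southeast_of (Q : seq bool) (c r : nat) : bool :=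
  has (fun k => (ptx Q k <= c) && (r.+1 <= pty Q k)) (iota 0 (size Q).+1).

Definition hook_filling (a b c r : nat) : int := level a b c.+1 r.

Definition positive_hooks (a b : nat) (P : seq bool) : seq nat :=
  [seq `|hook_filling a b x.1 x.2|%N | x <- boxes a b
     & southeast_of P x.1 x.2 && (0 < hook_filling a b x.1 x.2)%R].

(* A partition is the weakly decreasing sequence of its positive parts; rows
   and columns of its English-notation diagram are numbered from 0. *)
Definition is_partition (kappa : seq nat) : bool :=
  sorted geq kappa && all (leq 1) kappa.

Definition conj_part (kappa : seq nat) (j : nat) : nat :=
  count (fun p => j < p) kappa.

(* arm + leg + 1; meaningful for j < nth 0 kappa i *)
Definition hook_length (kappa : seq nat) (i j : nat) : nat :=
  (nth 0 kappa i - j.+1) + (conj_part kappa j - i.+1) + 1.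

Definition first_column_hooks (kappa : seq nat) : seq nat :=
  [seq hook_length kappa i 0 | i <- iota 0 (size kappa)].

(* The partition with a given set of first-column hook lengths: if these are
   h_0 > ... > h_(l-1), row i has h_i - (l - 1 - i) boxes.  See
   partition_of_hooksP and first_column_hooks_inj. *)
Definition partition_of_hooks (H : seq nat) : seq nat :=
  let s := sort geq (undup H) in
  [seq nth 0 s i - ((size s).-1 - i) | i <- iota 0 (size s)].

Definition core (a b : nat) (P : seq bool) : seq nat :=
  partition_of_hooks (positive_hooks a b P).

Definition m_rows (m : nat) (kappa : seq nat) : seq nat :=
  [seq i <- iota 0 (size kappa)
   | all (fun i' =>
        (hook_length kappa i' 0 == hook_length kappa i 0 %[mod m]) ==>
        (hook_length kappa i' 0 <= hook_length kappa i 0))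
      (iota 0 (size kappa))].

Definition boundary_in_row (m : nat) (kappa : seq nat) (i : nat) : nat :=
  count (fun j => hook_length kappa i j < m) (iota 0 (nth 0 kappa i)).

Definition boundary_parts (m n : nat) (kappa : seq nat) : seq nat :=
  let s := sort geq [seq boundary_in_row n kappa i | i <- m_rows m kappa] in
  s ++ nseq (m - size s) 0.

Definition lambda (a b : nat) (P : seq bool) : seq nat :=
  boundary_parts a b (core a b P).

Definition mu (a b : nat) (P : seq bool) : seq nat :=
  boundary_parts b a (core a b P).

(* The path, read from the southwest corner, whose northwest boxes form the
   English diagram of lam in the grid with size lam rows and b columns; see
   northwest_of_bounding_path. *)
Fixpoint path_rows (b x : nat) (s : seq nat) : seq bool :=
  if s is p :: s' then nseq (p - x) false ++ true :: path_rows b p s'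
  else nseq (b - x) false.

Definition bounding_path (b : nat) (lam : seq nat) : seq bool :=
  path_rows b 0 (rev lam).

Definition zeta (a b : nat) (P : seq bool) : seq bool :=
  bounding_path b (lambda a b P).

Definition eta (a b : nat) (P : seq bool) : seq bool :=
  bounding_path b [seq conj_part (mu a b P) j | j <- iota 0 a].

(* Reversing the order of the steps: the point (x,y) becomes (b-x,a-y). *)
Definition rotate180 (Q : seq bool) : seq bool := rev Q.

Definition row_label (a b : nat) (P : seq bool) (r : nat) : interval int :=
  let n := nth 0%R (sort <=%R (north_levels a b P)) r in `[n, n + b%:Z]%R.

Definition column_label (a b : nat) (P : seq bool) (c : nat) : interval int :=
  let e := nth 0%R (sort <=%R (east_levels a b P)) c in `[e - a%:Z, e]%R.

(* The end points are integers, so two label intervals share a real number if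
   and only if they share an integer. *)
Definition shaded (a b : nat) (P : seq bool) (c r : nat) : Prop :=
  ~ exists z : int, z \in row_label a b P r /\ z \in column_label a b P c.

(* Read off the level of the corner nearest the main diagonal. *)
Definition above_diagonal (a b c r : nat) : bool := (0 <= level a b c.+1 r)%R.
Definition below_diagonal (a b c r : nat) : bool := (level a b c r.+1 <= 0)%R.

Definition bounds_from_northwest (a b : nat) (S : nat -> nat -> Prop)
    (Q : seq bool) : Prop :=
  lattice_path a b Q /\
  forall c r, c < b -> r < a -> (S c r <-> northwest_of Q c r).

Definition bounds_from_southeast (a b : nat) (S : nat -> nat -> Prop)
    (Q : seq bool) : Prop :=
  lattice_path a b Q /\
  forall c r, c < b -> r < a -> (S c r <-> southeast_of Q c r).

Lemma gtn_sorted_nth (s : seq nat) i j : sorted gtn s -> i <= j < size s ->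
  nth 0 s j + (j - i) <= nth 0 s i.
Proof.
move=> ss; elim: j => [|j IH] /andP[le_ij lt_j].
  have -> : i = 0 by lia.
  by rewrite subnn addn0.
have [->|ne_ij] := eqVneq i j.+1; first by rewrite subnn addn0.
have {}IH := IH ltac:(lia).
have := sorted_ltn_nth (rev_trans ltn_trans) 0 ss.
move=> /(_ j j.+1 ltac:(rewrite inE; lia) lt_j (ltnSn j)) /=.
by lia.
Qed.

Lemma hook_length_col0 (kappa : seq nat) i : all (leq 1) kappa ->
  i < size kappa ->
  hook_length kappa i 0 = nth 0 kappa i + ((size kappa).-1 - i).
Proof.
move=> pos lt_i; rewrite /hook_length.
have -> : conj_part kappa 0 = size kappa by apply/eqP; rewrite -all_count.
by have := all_nthP 0 pos i lt_i; lia.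
Qed.

Lemma partition_of_hooksP (H : seq nat) : all (leq 1) H ->
  is_partition (partition_of_hooks H) /\
  first_column_hooks (partition_of_hooks H) =i H.
Proof.
move=> posH; rewrite /partition_of_hooks /=; set s := sort geq (undup H).
have ss : sorted gtn s.
  have tot : total geq by move=> x y /=; apply: leq_total.
  by rewrite gtn_sorted_uniq_geq sort_uniq undup_uniq sort_sorted.
have memS : s =i H by move=> x; rewrite mem_sort mem_undup.
clearbody s.
have pos i : i < size s -> (size s).-1 - i < nth 0 s i.
  move=> lt_i; have := @gtn_sorted_nth s i (size s).-1 ss ltac:(lia).
  have : 0 < nth 0 s (size s).-1.
    by apply: (allP posH); rewrite -memS mem_nth // ltn_predL; apply: leq_ltn_trans lt_i.
  by lia.
set kappa := map _ (iota 0 (size s)).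
have szk : size kappa = size s by rewrite size_map size_iota.
have nthk i : i < size s -> nth 0 kappa i = nth 0 s i - ((size s).-1 - i).
  by move=> lt_i; rewrite (nth_map 0) ?size_iota // nth_iota.
have posk : all (leq 1) kappa.
  apply/(all_nthP 0) => i; rewrite szk => lt_i; rewrite nthk //.
  by have := pos i lt_i; lia.
split.
  rewrite /is_partition posk andbT; apply/(sortedP 0) => i; rewrite szk => lt_i.
  rewrite /= !nthk; [|lia..].
  by have := @gtn_sorted_nth s i i.+1 ss ltac:(lia); lia.
move=> x; rewrite -memS; congr (x \in _); apply: (@eq_from_nth _ 0).
  by rewrite size_map size_iota.
rewrite size_map size_iota szk => i lt_i.
rewrite (nth_map 0) ?size_iota ?szk // nth_iota // add0n.
rewrite hook_length_col0 ?szk // nthk //.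
by have := pos i lt_i; lia.
Qed.

Lemma first_column_hooks_inj (kappa kappa' : seq nat) :
  is_partition kappa -> is_partition kappa' ->
  first_column_hooks kappa =i first_column_hooks kappa' -> kappa = kappa'.
Proof.
have nthF k i : is_partition k -> i < size k ->
    nth 0 (first_column_hooks k) i = nth 0 k i + ((size k).-1 - i).
  move=> /andP[_ pos] lt_i.
  by rewrite (nth_map 0) ?size_iota // nth_iota // hook_length_col0.
have szF k : size (first_column_hooks k) = size k.
  by rewrite size_map size_iota.
have sortF k : is_partition k -> sorted gtn (first_column_hooks k).
  move=> pk; apply/(sortedP 0) => i; rewrite szF => lt_i /=.
  rewrite !nthF //; last lia.
  have /andP[/(sortedP 0) /(_ i lt_i) /= ] := pk.
  by lia.
move=> pk pk' eqF.
have {}eqF := irr_sorted_eq (rev_trans ltn_trans) ltnn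
  (sortF _ pk) (sortF _ pk') eqF.
have eqsz : size kappa = size kappa' by rewrite -szF eqF szF.
apply: (@eq_from_nth _ 0) => // i lt_i.
have lt_i' : i < size kappa' by rewrite -eqsz.
have := nthF _ i pk' lt_i'; rewrite -eqF (nthF _ i pk lt_i) eqsz.
exact: addIn.
Qed.

(* northwest_of for a path starting at (x, y) *)
Definition northwest_from (x y c r : nat) (Q : seq bool) : bool :=
  has (fun k => (c < x + ptx Q k) && (y + pty Q k <= r)) (iota 0 (size Q).+1).

Lemma northwest_from_cons x y c r t Q : northwest_from x y c r (t :: Q) =
  ((c < x) && (y <= r)) || northwest_from (x + ~~ t) (y + t) c r Q.
Proof.
rewrite /northwest_from [size (t :: Q)]/= -[(size Q).+2]add1n iotaD has_cat.
congr orb; first by rewrite /= /ptx /pty !take0 /= !addn0 orbF.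
rewrite addnC iotaDl has_map; apply: eq_has => k /=.
by rewrite !addnA.
Qed.

Lemma northwest_from_start x y c r Q :
  c < x -> y <= r -> northwest_from x y c r Q.
Proof.
by move=> cx yr; rewrite /northwest_from /= /ptx /pty !take0 /= !addn0 cx yr.
Qed.

Lemma northwest_from_east x y c r n Q :
  northwest_from x y c r (nseq n false ++ Q) = northwest_from (x + n) y c r Q.
Proof.
elim: n x => [|n IH] x; first by rewrite addn0.
rewrite (northwest_from_cons x y c r false) /= addn0 addn1 IH addSnnS.
case: andP => // -[cx yr] /=; apply/esym/northwest_from_start => //; lia.
Qed.

Lemma northwest_from_path_rows (b x y c r : nat) (s : seq nat) :
  x <= b -> path leq x s -> all (fun p => p <= b) s ->
  northwest_from x y c r (path_rows b x s) = (y <= r) && (c < nth b s (r - y)).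
Proof.
elim: s x y => [|p s IH] x y lexb /=.
  move=> _ _; rewrite nth_nil -[nseq _ _]cats0 northwest_from_east subnKC //.
  by rewrite /northwest_from /= !addn0 orbF andbC.
move=> /andP[lexp ps] /andP[lepb ls].
rewrite northwest_from_east subnKC // northwest_from_cons addn0 addn1 IH //.
have [ltyr|lery|<-] := ltngtP y r; last 2 first.
- by rewrite andbF.
- by rewrite subnn /= andbT orbF.
have -> : r - y = (r - y.+1).+1 by lia.
rewrite /= andbT; apply/orb_idl => ltcp; apply: leq_trans ltcp _.
have [lts|ges] := ltnP (r - y.+1) (size s); last by rewrite nth_default.
by have /(all_nthP b) /(_ _ lts) := order_path_min leq_trans ps.
Qed.

Lemma lattice_path_rows (b x : nat) (s : seq nat) :
  x <= b -> path leq x s -> all (fun p => p <= b) s ->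
  lattice_path (size s) (b - x) (path_rows b x s).
Proof.
rewrite /lattice_path; elim: s x => [|p s IH] x lexb /=.
  by move=> _ _; rewrite !count_nseq /= mul1n !eqxx.
move=> /andP[lexp ps] /andP[lepb ls].
have /andP[/eqP cN /eqP cE] := IH p lepb ps ls.
rewrite !count_cat !count_nseq /= cN cE; lia.
Qed.

Lemma northwest_of_bounding_path (b : nat) (lam : seq nat) :
  sorted geq lam -> all (fun p => p <= b) lam ->
  lattice_path (size lam) b (bounding_path b lam) /\
  forall c r, c < b -> r < size lam ->
    northwest_of (bounding_path b lam) c r = (c < nth 0 lam (size lam - r.+1)).
Proof.
move=> slam lelam; have lelam' : all (fun p => p <= b) (rev lam).
  by rewrite all_rev.
have plam : path leq 0 (rev lam).
  by rewrite path_min_sorted ?rev_sorted //; apply/allP.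
split.
  by have := lattice_path_rows (leq0n b) plam lelam'; rewrite size_rev subn0.
move=> c r ltc ltr.
have := northwest_from_path_rows 0 c r (leq0n b) plam lelam'.
by rewrite subn0 /= (set_nth_default 0) ?size_rev // nth_rev // => <-.
Qed.

(* Main.v *)
Require Import Defs.
From mathcomp Require Import all_boot all_order all_algebra.
From mathcomp Require Import zify.

Set Implicit Arguments.
Unset Strict Implicit.
Unset Printing Implicit Defensive.

Import Order.TTheory GRing.Theory Num.Theory.

(** Call an integer a gap if it is nonnegative and is not a positive hook of P.
   Both the north steps and the east steps describe the gaps.  The north levels
   n_i lie in different classes modulo a and n_i is the least gap in its class;
   likewise the end levels m_j = e_j - a of the east steps are the least gaps in
   the classes modulo b.  Hence the gaps are the numbers n_i + k a and also the
   numbers m_j + k b with k >= 0 ([positive_hooks_north],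
   [positive_hooks_east]).

   The hook lengths in the row of the core with first-column hook h are the
   numbers h - g, for the gaps g < h ([row_hooks]).  The a-rows have
   h = n_i - a, so the boxes of the b-boundary in such a row correspond to
   the gaps in the window (n_i - a - b, n_i - a).  The window meets every class
   modulo b other than that of h once, and the class of m_j in a gap exactly when
   m_j < n_i - a, that is, when e_j < n_i.  So the parts of lambda count, for
   each north interval, the east intervals that lie entirely to its left;
   symmetrically, the parts of mu count, for each east interval, the north
   intervals entirely to its left ([boundary_parts_gaps], [lambda_levels],
   [mu_levels]).  After sorting, the box (c, r) is thus northwest of zeta exactly
   when e_c < n_r, and southeast of the rotated eta exactly when
   n_r + b < e_c - a.  These two cases are the two ways for the intervals to be
   disjoint.

   It remains to see that the first kind of shaded box lies above the main
   diagonal and the second kind below it.  Truncate the level at a height nu and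
   follow the closed walk of levels from 0 back to 0.  A step starting below nu
   changes the level by at least as much as the truncated level, and the
   truncated level does not increase in any other step; summing,
   a #{e_j < nu} <= b #{n_i < nu} ([starts_below_slope]).  Counting the steps that
   end below nu reverses the inequality ([ends_below_slope]).  For the sorted
   levels, nu = n_r gives a (c + 1) <= b r in the first case, and nu = e_c - a
   gives b (r + 1) <= a c in the second. *)

(** * Hook lengths in a row of a partition *)

Lemma lt_conj_part kappa i j :
  sorted geq kappa -> (i < conj_part kappa j) = (j < nth 0 kappa i).
Proof.
rewrite /conj_part; elim: kappa i => [|p kappa IH] i pk; first by rewrite nth_nil.
have {}IH := IH ^~ (path_sorted pk); rewrite /=.
have [ltjp|lepj] := ltnP j p; first by case: i => [|i] //=; rewrite ltnS IH.
have allp : all (geq p) kappa.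
  by apply: (order_path_min _ pk) => x y z /= lexy lezx; apply: leq_trans lexy.
have -> : count (fun q => j < q) kappa = 0.
  apply/eqP; rewrite -leqn0 leqNgt -has_count; apply/hasPn => q /(allP allp) /=.
  by lia.
case: i => [|i]; rewrite /= addn0; first lia.
have [lti|gei] := ltnP i (size kappa); last by rewrite nth_default.
by have /= := all_nthP 0 allp i lti; lia.
Qed.

Lemma size_first_column_hooks kappa :
  size (first_column_hooks kappa) = size kappa.
Proof. by rewrite size_map size_iota. Qed.

Lemma nth_first_column_hooks kappa i : all (leq 1) kappa -> i < size kappa ->
  nth 0 (first_column_hooks kappa) i = nth 0 kappa i + ((size kappa).-1 - i).
Proof.
move=> pos lti; rewrite (nth_map 0) ?size_iota // nth_iota //.
exact: hook_length_col0.
Qed.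

Lemma sorted_first_column_hooks kappa :
  is_partition kappa -> sorted gtn (first_column_hooks kappa).
Proof.
move=> /andP[/(sortedP 0) sk pos]; apply/(sortedP 0) => i.
rewrite size_first_column_hooks => lti; have /= := sk i lti.
by rewrite /= !nth_first_column_hooks //; lia.
Qed.

(** The first-column hooks and the missing numbers label the vertical and the
   horizontal steps of the boundary of the diagram, and a hook length is the
   difference of the labels of the steps at the end of the arm and of the leg. *)
Lemma row_hooks kappa i : is_partition kappa -> i < size kappa ->
  perm_eq [seq hook_length kappa i j | j <- iota 0 (nth 0 kappa i)]
    [seq hook_length kappa i 0 - g
    | g <- iota 0 (hook_length kappa i 0) & g \notin first_column_hooks kappa].
Proof.
move=> pk lti; have /andP[sk pos] := pk.
rewrite hook_length_col0 //; set h := _ + _.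
have szF := size_first_column_hooks kappa.
have nthF := nth_first_column_hooks pos.
have sF := sorted_first_column_hooks pk.
have uF : uniq (first_column_hooks kappa).
  exact: sorted_uniq (rev_trans ltn_trans) ltnn _ sF.
(* The label of the boundary step below column j, when the steps are numbered
   from the bottom left so that row i' ends at its first-column hook. *)
pose missing j := j + (size kappa - conj_part kappa j).
have conj_le j : conj_part kappa j <= size kappa by apply: count_size.
have conj_mono j j' : j <= j' -> conj_part kappa j' <= conj_part kappa j.
  by move=> lejj'; apply: sub_count => p /=; lia.
have -> : [seq hook_length kappa i j | j <- iota 0 (nth 0 kappa i)] =
    [seq h - g | g <- [seq missing j | j <- iota 0 (nth 0 kappa i)]].
  rewrite -map_comp; apply/eq_in_map => j; rewrite mem_iota add0n /= => ltj.
  have := lt_conj_part i j sk; rewrite ltj /hook_length /missing /h.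
  by have := conj_le j; lia.
have uniq_missing : uniq [seq missing j | j <- iota 0 (nth 0 kappa i)].
  rewrite map_inj_uniq ?iota_uniq // /missing => j j'.
  have := conj_mono j j'; have := conj_mono j' j.
  by have := conj_le j; have := conj_le j'; lia.
apply: perm_map; apply: uniq_perm.
- exact: uniq_missing.
- by rewrite filter_uniq ?iota_uniq.
apply: (uniq_min_size _ _ _).2.
- exact: uniq_missing.
- move=> x /mapP[j]; rewrite mem_iota add0n /= => ltj ->{x}.
  have := lt_conj_part i j sk; rewrite ltj => lt_conj.
  rewrite mem_filter mem_iota add0n /= /missing /h.
  apply/andP; split; last by have := conj_le j; lia.
  apply/(nthP 0) => -[k]; rewrite szF => ltk; rewrite nthF //.
  by have := lt_conj_part k j sk; have := conj_le j; lia.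
(* The first-column hooks of the rows below row i are all less than h, so at most
   as many numbers below h are missing as row i has boxes. *)
- rewrite size_map size_iota size_filter.
  have := count_predC (mem (first_column_hooks kappa)) (iota 0 h).
  rewrite size_iota.
  have : size (drop i.+1 (first_column_hooks kappa)) <=
      count (mem (first_column_hooks kappa)) (iota 0 h).
    rewrite -size_filter; apply: uniq_leq_size; first exact: drop_uniq.
    move=> x xF; rewrite mem_filter /= (mem_drop xF) /=.
    case/(nthP 0): xF => k; rewrite size_drop szF => ltk.
    rewrite nth_drop => <-; rewrite mem_iota add0n /= {}/h -nthF //.
    by apply: (sorted_ltn_nth (rev_trans ltn_trans) 0 sF);
      rewrite ?inE ?szF; lia.
  rewrite size_drop szF.
  rewrite -[count (predC _) _]/(count [pred g | g \notin
    first_column_hooks kappa] _) {}/h /=.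
  by lia.
Qed.

(** * Boundary boxes and gaps *)

Definition residue_system (m : nat) (N : seq int) : bool :=
  (size N == m) && uniq [seq (nu %% m)%Z | nu <- N].

(** The union of the progressions nu, nu + m, nu + 2 m, ... for nu in N.  For a
   residue system N, these nu are the least elements of the classes modulo m. *)
Definition gap (m : nat) (N : seq int) (z : int) : bool :=
  has (fun nu => (nu <= z)%R && (nu == z %[mod m])%Z) N.

Lemma modz_eq_ltD (m : nat) (x y : int) :
  (x = y %[mod m])%Z -> (x < y)%R -> (x + m%:Z <= y)%R.
Proof.
move=> /eqP; rewrite eqz_mod_dvd => /dvdzP[q eq_q] lt_xy.
have : (q <= -1)%R by nia.
nia.
Qed.

Section ResidueSystem.

Variables (m : nat) (N : seq int).
Hypothesis (m_gt0 : 0 < m) (sysN : residue_system m N).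

Lemma residue_system_inj nu nu' : nu \in N -> nu' \in N ->
  (nu = nu' %[mod m])%Z -> nu = nu'.
Proof.
have /andP[_ /(uniqP 0%R) injN] := sysN.
move=> /(nthP 0%R)[i lti <-] /(nthP 0%R)[j ltj <-] eq_mod.
congr nth; apply: injN; rewrite ?inE ?size_map //.
by rewrite !(nth_map 0%R).
Qed.

Lemma residue_system_cover (z : int) :
  exists2 nu, nu \in N & (nu = z %[mod m])%Z.
Proof.
have /andP[/eqP szN uN] := sysN.
have m_neq0 : Posz m != 0%R by lia.
have sub : {subset [seq (nu %% m)%Z | nu <- N] <= [seq Posz i | i <- iota 0 m]}.
  move=> _ /mapP[nu _ ->]; apply/mapP; exists `|(nu %% m)%Z|%N.
    by have := modz_ge0 nu m_neq0; have := ltz_pmod nu (d := m);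
      rewrite mem_iota; lia.
  by have := modz_ge0 nu m_neq0; lia.
have [|_ eqN] := uniq_min_size uN sub; first by rewrite !size_map size_iota szN.
have : (z %% m)%Z \in [seq Posz i | i <- iota 0 m].
  apply/mapP; exists `|(z %% m)%Z|%N.
    by have := modz_ge0 z m_neq0; have := ltz_pmod z (d := m);
      rewrite mem_iota; lia.
  by have := modz_ge0 z m_neq0; lia.
by rewrite -eqN => /mapP[nu inN ->]; exists nu.
Qed.

End ResidueSystem.

Lemma geq_trans : transitive geq.
Proof. by move=> x y z /= lexy lezx; apply: leq_trans lexy. Qed.

(** A box of the boundary is a gap in the window (h - n, h), where h is the
   first-column hook of the row.  The gaps in the window and the mu < h represent
   the same classes modulo n, each of them once, which gives the equality. *)
Lemma boundary_in_row_gaps n kappa i M :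
  0 < n -> residue_system n M -> all (fun mu => 0 <= mu)%R M ->
  is_partition kappa ->
  (forall h : nat, (h \in first_column_hooks kappa) = ~~ gap n M h) ->
  i < size kappa ->
  boundary_in_row n kappa i =
    count (fun mu => (mu < Posz (hook_length kappa i 0))%R) M.
Proof.
move=> n_gt0 sysM posM pk hooksE lti.
have hF : hook_length kappa i 0 \in first_column_hooks kappa.
  by apply/mapP; exists i; rewrite // mem_iota.
have -> : boundary_in_row n kappa i = count (fun k => k < n)
    [seq hook_length kappa i j | j <- iota 0 (nth 0 kappa i)].
  by rewrite count_map.
rewrite (permP (row_hooks pk lti)) count_map count_filter -!size_filter.
move: (hook_length kappa i 0) hF => h; rewrite hooksE => /hasPn hF.
set W := filter _ (iota 0 h); set V := filter _ M.
have memW g : (g \in W) = [&& h < g + n, gap n M (Posz g) & g < h].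
  by rewrite mem_filter mem_iota /= hooksE negbK; case: gap => /=; lia.
rewrite -(size_map (fun g : nat => (Posz g %% n)%Z) W).
rewrite -(size_map (fun mu => (mu %% n)%Z) V).
(* Both sides are compared through residues modulo n. *)
apply/perm_size/uniq_perm.
- rewrite map_inj_in_uniq ?filter_uniq ?iota_uniq // => g g'.
  rewrite !memW => /and3P[lt_h _ lt_g] /and3P[lt_h' _ lt_g'] eq_gg'.
  have := @modz_eq_ltD n (Posz g) (Posz g') eq_gg'.
  by have := @modz_eq_ltD n (Posz g') (Posz g) (esym eq_gg'); lia.
- have /andP[_ uM] := sysM.
  exact: subseq_uniq (map_subseq _ (filter_subseq _ _)) uM.
move=> x; apply/mapP/mapP => -[].
  move=> g; rewrite memW => /and3P[lt_h /hasP[mu inM /andP[le_mu /eqP eq_mu]] lt_g] ->.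
  exists mu; last by rewrite eq_mu.
  by rewrite mem_filter inM andbT; lia.
move=> mu; rewrite mem_filter => /andP[lt_mu inM] ->.
have mu_ge0 := allP posM _ inM.
(* The representative of the class of mu in the window [h - n, h). *)
pose r := modz (mu - (Posz h - n%:Z))%R n; pose g := (Posz h - n%:Z + r)%R.
have eq_g : (mu = g %[mod n])%Z by rewrite /g modzDmr addrC subrK.
have r_ge0 : (0 <= r)%R by apply: modz_ge0; lia.
have r_lt : (r < n%:Z)%R by apply: ltz_pmod.
have le_mu : (mu <= g)%R.
  rewrite leNgt; apply/negP => /(modz_eq_ltD (esym eq_g)); rewrite /g; lia.
have g_ge : (Posz h - n%:Z <= g)%R by rewrite /g; lia.
have g_lt : (g < Posz h)%R by rewrite /g; lia.
(* The left end of the window is excluded because h would then be a gap too. *)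
have g_neq : g != (Posz h - n%:Z)%R.
  apply/eqP => eq_gh; have := hF _ inM; apply/negP; rewrite negbK.
  apply/andP; split; first lia.
  by rewrite eq_g eq_gh -modzDr subrK.
exists `|g|%N; last by rewrite eq_g; congr modz; lia.
rewrite memW; apply/and3P; split; [lia| |lia].
apply/hasP; exists mu => //; apply/andP; split; first lia.
by apply/eqP; rewrite eq_g; congr modz; lia.
Qed.

Section BoundaryParts.

Variables (m n : nat) (N M : seq int) (H : seq nat).
Hypotheses (m_gt0 : 0 < m) (n_gt0 : 0 < n).
Hypotheses (sysN : residue_system m N) (sysM : residue_system n M).
Hypothesis (posM : all (fun mu => 0 <= mu)%R M).
Hypothesis (posH : all (leq 1) H).
Hypothesis (gapN : forall h : nat, (h \in H) = ~~ gap m N h).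
Hypothesis (gapM : forall h : nat, (h \in H) = ~~ gap n M h).

Let kappa := partition_of_hooks H.

(** The largest hook in a class modulo m is the number m below the least gap nu
   of the class, provided that nu - m is positive. *)
Lemma m_rows_hooks :
  perm_eq [seq Posz (hook_length kappa i 0) | i <- m_rows m kappa]
    [seq (nu - m%:Z)%R | nu <- N & (m%:Z < nu)%R].
Proof.
have [pk hooksE] := partition_of_hooksP posH; rewrite -/kappa in pk hooksE.
have uF : uniq (first_column_hooks kappa).
  apply: sorted_uniq (rev_trans ltn_trans) ltnn _ _.
  exact: sorted_first_column_hooks.
have memH i : i < size kappa -> hook_length kappa i 0 \in H.
  by move=> lti; rewrite -hooksE; apply/mapP; exists i; rewrite // mem_iota.
have non_gap nu h : nu \in N -> (nu = Posz h %[mod m])%Z -> h \in H ->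
    (Posz h + Posz m <= nu)%R.
  move=> inN eq_nu; rewrite gapN => /hasPn /(_ _ inN).
  rewrite eq_nu eqxx andbT -ltNge => lt_h.
  exact: (modz_eq_ltD (esym eq_nu)).
apply: uniq_perm.
- rewrite (map_comp Posz) map_inj_uniq; last by move=> ? ? [].
  rewrite /m_rows; apply: (subseq_uniq _ uF).
  exact: map_subseq (filter_subseq _ _).
- rewrite map_inj_uniq; last exact: addIr.
  by rewrite filter_uniq //; have /andP[_ /map_uniq] := sysN.
have sub_mod (nu : int) : ((nu - m%:Z)%R = nu %[mod m])%Z.
  by rewrite -modzDr subrK.
have mem_sub nu : nu \in N -> (m%:Z < nu)%R -> `|(nu - m%:Z)%R|%N \in H.
  move=> inN lt_nu; rewrite gapN; apply/hasPn => nu' inN'.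
  apply/negP => /andP[le_nu /eqP eq_nu].
  have := residue_system_inj sysN inN' inN; rewrite eq_nu.
  have -> : Posz `|(nu - m%:Z)%R|%N = (nu - m%:Z)%R by lia.
  by rewrite sub_mod => /(_ erefl); lia.
move=> x; apply/mapP/mapP => -[].
- move=> i; rewrite mem_filter mem_iota add0n /= => /andP[/allP max_i lti] ->.
  have [nu inN eq_nu] := residue_system_cover m_gt0 sysN (Posz (hook_length kappa i 0)).
  have le_h := non_gap _ _ inN eq_nu (memH i lti).
  have h_gt0 := allP posH _ (memH i lti).
  have lt_nu : (m%:Z < nu)%R by lia.
  exists nu; first by rewrite mem_filter lt_nu.
  have := mem_sub nu inN lt_nu; rewrite -hooksE => /mapP[i' ii' eq_i'].
  have := max_i i' ii'; rewrite -eq_i'.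
  have -> : `|(nu - m%:Z)%R|%N = hook_length kappa i 0 %[mod m].
    apply/eqP; rewrite -eqz_nat -!modz_nat -eq_nu.
    have -> : Posz `|(nu - m%:Z)%R|%N = (nu - m%:Z)%R by lia.
    by rewrite sub_mod.
  by rewrite eqxx /=; lia.
- move=> nu; rewrite mem_filter => /andP[lt_nu inN] ->.
  have := mem_sub nu inN lt_nu; rewrite -hooksE => /mapP[i ii eq_i].
  exists i; last by rewrite -eq_i; lia.
  rewrite mem_filter ii andbT; apply/allP => i' ii'.
  apply/implyP => /eqP eq_mod; rewrite -eq_i.
  have lti' : i' < size kappa by move: ii'; rewrite mem_iota.
  have : (nu = Posz (hook_length kappa i' 0) %[mod m])%Z.
    rewrite !modz_nat eq_mod -eq_i -modz_nat.
    have -> : Posz `|(nu - m%:Z)%R|%N = (nu - m%:Z)%R by lia.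
    by rewrite sub_mod.
  by move=> eq_nu; have := non_gap nu _ inN eq_nu (memH i' lti'); lia.
Qed.

(** The classes modulo m that contain no hook have nu <= m; they contribute the
   zeros with which the parts are padded. *)
Lemma boundary_parts_gaps :
  perm_eq (boundary_parts m n kappa)
    [seq count (fun mu => mu < nu - m%:Z)%R M | nu <- N].
Proof.
have [pk hooksE] := partition_of_hooksP posH; rewrite -/kappa in pk hooksE.
pose F (x : int) := count (fun mu => mu < x)%R M.
have /andP[/eqP szN _] := sysN.
set S := [seq boundary_in_row n kappa i | i <- m_rows m kappa].
have permS : perm_eq S [seq F (nu - m%:Z)%R | nu <- N & (m%:Z < nu)%R].
  rewrite [X in perm_eq _ X](map_comp F (fun nu => nu - m%:Z)%R).
  have -> : S = map F [seq Posz (hook_length kappa i 0) | i <- m_rows m kappa].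
    rewrite -map_comp; apply/eq_in_map => i.
    rewrite mem_filter mem_iota /= => /andP[_ lti].
    by apply: boundary_in_row_gaps => // h; rewrite hooksE.
  by rewrite perm_map // m_rows_hooks.
have F0 x : (x <= 0)%R -> F x = 0.
  move=> le_x0; apply/eqP; rewrite -leqn0 leqNgt -has_count.
  by apply/hasPn => mu /(allP posM); lia.
have le_szS : size S <= m.
  by rewrite (perm_size permS) size_map size_filter -szN count_size.
apply: perm_trans (_ : perm_eq _ (S ++ nseq (m - size S) 0)) _.
  by rewrite /boundary_parts -/S size_sort perm_cat2r perm_sort.
have /permEl permN := perm_filterC (fun nu => m%:Z < nu)%R N.
rewrite perm_sym; apply: perm_trans (_ : perm_eq _ _) _.
  by rewrite perm_sym; apply: perm_map permN.
rewrite map_cat; apply: perm_cat; first by rewrite perm_sym.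
set Z := filter _ N.
have szZ : m - size S = size Z.
  have := count_predC (fun nu => m%:Z < nu)%R N; rewrite szN.
  rewrite (perm_size permS) size_map /Z !size_filter /predC /=.
  by move=> eq_m; rewrite -[X in X - _]eq_m addKn.
suff eqZ : [seq F (nu - m%:Z)%R | nu <- Z] = nseq (m - size S) 0.
  by rewrite -eqZ perm_refl.
rewrite szZ -[size Z](size_map (fun nu => F (nu - m%:Z)%R)).
apply/all_pred1P/allP => _ /mapP[nu + ->]; rewrite mem_filter /= -leNgt.
by move=> /andP[le_nu _]; apply/eqP/F0; lia.
Qed.

End BoundaryParts.

Lemma sorted_boundary_parts m n kappa : sorted geq (boundary_parts m n kappa).
Proof.
rewrite /boundary_parts (sorted_pairwise geq_trans) pairwise_cat.
rewrite -!(sorted_pairwise geq_trans) sort_sorted => [|x y]; last exact: leq_total.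
apply/and3P; split=> //.
  by apply/allrelP => x y _; rewrite mem_nseq => /andP[_ /eqP ->].
apply/(sortedP 0) => i; rewrite size_nseq => lti; rewrite !nth_nseq /=.
by case: ifP => //; case: ifP.
Qed.

(** * Levels along a lattice path *)

Section PathLevels.

Variables (a b : nat) (Q : seq bool).

Definition path_level (k : nat) : int := level a b (ptx Q k) (pty Q k).

Lemma ptxS k : k < size Q -> ptx Q k.+1 = ptx Q k + ~~ nth false Q k.
Proof.
by move=> ltk; rewrite /ptx (take_nth false ltk) -cats1 count_cat /= addn0.
Qed.

Lemma ptyS k : k < size Q -> pty Q k.+1 = pty Q k + nth false Q k.
Proof.
by move=> ltk; rewrite /pty (take_nth false ltk) -cats1 count_cat /= addn0.
Qed.

Lemma count_take_mono (p : pred bool) k k' :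
  k <= k' -> count p (take k Q) <= count p (take k' Q).
Proof.
by move=> lekk'; rewrite -(take_takel Q lekk') leq_count_subseq ?take_subseq.
Qed.

Lemma ptx_mono k k' : k <= k' -> ptx Q k <= ptx Q k'.
Proof. exact: count_take_mono. Qed.

Lemma pty_mono k k' : k <= k' -> pty Q k <= pty Q k'.
Proof. exact: count_take_mono. Qed.

Lemma path_level0 : path_level 0 = 0%R.
Proof. by rewrite /path_level /ptx /pty take0 /level /= !muln0. Qed.

Lemma path_levelS k : k < size Q -> path_level k.+1 =
  (path_level k + (if nth false Q k then b%:Z else - a%:Z))%R.
Proof.
move=> ltk; rewrite /path_level ptxS // ptyS // /level.
by case: nth => /=; lia.
Qed.

Lemma count_north_levels (p : pred int) : count p (north_levels a b Q) =
  count (fun k => nth false Q k && p (path_level k)) (iota 0 (size Q)).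
Proof.
by rewrite count_map count_filter; apply: eq_count => k /=; rewrite andbC.
Qed.

Lemma count_east_levels (p : pred int) : count p (east_levels a b Q) =
  count (fun k => ~~ nth false Q k && p (path_level k)) (iota 0 (size Q)).
Proof.
by rewrite count_map count_filter; apply: eq_count => k /=; rewrite andbC.
Qed.

(** The right-hand side adds up the changes of level over the steps that start
   below nu; each step changes it by at least as much as it changes the truncated
   level on the left. *)
Lemma starts_below_prefix (nu : int) k : k <= size Q ->
  (Order.min (path_level k) nu - Order.min 0 nu <=
    b%:Z * (count (fun i => nth false Q i && (path_level i < nu)%R) (iota 0 k))%:Z
    - a%:Z * (count (fun i => ~~ nth false Q i && (path_level i < nu)%R)
        (iota 0 k))%:Z)%R.
Proof.
elim: k => [|k IH] ltk; first by rewrite path_level0 /= !mulr0 !subrr.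
have {}IH := IH (ltnW ltk).
rewrite -addn1 iotaD !count_cat add0n addn1 path_levelS //= !addn0 !PoszD !mulrDr.
move: IH; move: (count _ _) (count _ _) => x y.
case: nth => /=; case: ltP => /=; lia.
Qed.

(** The left-hand side adds up the changes of level over the steps that end below
   nu; the comparison with the truncated level is now the opposite one. *)
Lemma ends_below_prefix (nu : int) k : k <= size Q ->
  (b%:Z * (count (fun i => nth false Q i && (path_level i + b%:Z < nu)%R) (iota 0 k))%:Z
    - a%:Z * (count (fun i => ~~ nth false Q i && (path_level i - a%:Z < nu)%R)
        (iota 0 k))%:Z
    <= Order.min (path_level k) nu - Order.min 0 nu)%R.
Proof.
elim: k => [|k IH] ltk; first by rewrite path_level0 /= !mulr0 !subrr.
have {}IH := IH (ltnW ltk).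
rewrite -addn1 iotaD !count_cat add0n addn1 path_levelS //= !addn0 !PoszD !mulrDr.
move: IH; move: (count _ _) (count _ _) => x y.
case: nth => /=; case: ltP => /=; lia.
Qed.

End PathLevels.

(** * Levels and positive hooks of a Dyck path *)

Lemma dvd_coprime_small (m n : nat) (z : int) : coprime m n ->
  (m%:Z %| (n%:Z * z)%R)%Z -> `|z|%N < m -> z = 0%R.
Proof.
move=> co; rewrite Gauss_dvdzr; last by rewrite coprimezE.
by rewrite dvdzE /= => dvd ltz; have := dvdn_leq _ dvd; lia.
Qed.

Lemma level_mod_row a b x y x' y' : coprime a b -> y < a -> y' < a ->
  (level a b x y = level a b x' y' %[mod a])%Z -> y = y'.
Proof.
move=> coprime_ab lty lty' /eqP; rewrite eqz_mod_dvd /level.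
have -> : ((b * y)%N%:Z - (a * x)%N%:Z - ((b * y')%N%:Z - (a * x')%N%:Z) =
  b%:Z * (y%:Z - y'%:Z) + (x'%:Z - x%:Z) * a%:Z)%R by lia.
rewrite (rpredDr _ (dvdz_mull _ (dvdzz _))) => dvd_a.
by have := dvd_coprime_small coprime_ab dvd_a; lia.
Qed.

Lemma level_mod_column a b x y x' y' : coprime a b -> x < b -> x' < b ->
  (level a b x.+1 y = level a b x'.+1 y' %[mod b])%Z -> x = x'.
Proof.
move=> coprime_ab ltx ltx' /eqP; rewrite eqz_mod_dvd /level.
have -> : ((b * y)%N%:Z - (a * x.+1)%N%:Z - ((b * y')%N%:Z - (a * x'.+1)%N%:Z) =
  a%:Z * (x'%:Z - x%:Z) + (y%:Z - y'%:Z) * b%:Z)%R by lia.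
rewrite (rpredDr _ (dvdz_mull _ (dvdzz _))) => dvd_b.
have coprime_ba : coprime b a by rewrite coprime_sym.
by have := dvd_coprime_small coprime_ba dvd_b; lia.
Qed.

Section DyckLevels.

Variables (a b : nat) (P : seq bool).
Hypothesis (dyckP : dyck_path a b P).

Let N := north_levels a b P.
Let M := [seq (e - a%:Z)%R | e <- east_levels a b P].
Let lev := path_level a b P.

Lemma dyck_count_north : count id P = a.
Proof. by have /andP[/andP[/eqP]] := dyckP. Qed.

Lemma dyck_count_east : count negb P = b.
Proof. by have /andP[/andP[_ /eqP]] := dyckP. Qed.

Lemma dyck_size : size P = a + b.
Proof. by rewrite -dyck_count_north -dyck_count_east; apply/esym/count_predC. Qed.

Lemma ptx_size : ptx P (size P) = b.
Proof. by rewrite /ptx take_size dyck_count_east. Qed.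

Lemma pty_size : pty P (size P) = a.
Proof. by rewrite /pty take_size dyck_count_north. Qed.

Lemma dyck_level_ge0 k : k <= size P -> (0 <= lev k)%R.
Proof.
move=> lek; have /andP[_ /allP /(_ k)] := dyckP.
by rewrite mem_iota ltnS lek /lev /path_level /level => /(_ isT); lia.
Qed.

Lemma dyck_level_size : lev (size P) = 0%R.
Proof. by rewrite /lev /path_level ptx_size pty_size /level mulnC subrr. Qed.

Lemma size_north_levels : size N = a.
Proof.
rewrite size_map size_filter -[RHS]dyck_count_north.
by rewrite -[in RHS](mkseq_nth false P) count_map.
Qed.

Lemma size_east_levels : size (east_levels a b P) = b.
Proof.
rewrite size_map size_filter -[RHS]dyck_count_east.
by rewrite -[in RHS](mkseq_nth false P) count_map.
Qed.

Lemma north_step_row k : k < size P -> nth false P k -> pty P k < a.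
Proof.
move=> ltk nk; have := ptyS ltk; rewrite nk /= => eq_y.
by have := pty_mono P ltk; rewrite pty_size eq_y; lia.
Qed.

Lemma east_step_column k : k < size P -> ~~ nth false P k -> ptx P k < b.
Proof.
move=> ltk nk; have := ptxS ltk; rewrite nk /= => eq_x.
by have := ptx_mono P ltk; rewrite ptx_size eq_x; lia.
Qed.

Lemma north_levelP nu : reflect
  (exists k, [/\ k < size P, nth false P k & nu = lev k]) (nu \in N).
Proof.
apply: (iffP mapP) => [[k]|[k [ltk nk ->]]].
  by rewrite mem_filter mem_iota => /andP[nk ltk] ->; exists k.
by exists k; rewrite // mem_filter nk mem_iota.
Qed.

Lemma east_end_levelP mu : reflect
  (exists k, [/\ k < size P, ~~ nth false P k & mu = lev k.+1]) (mu \in M).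
Proof.
apply: (iffP mapP) => [[_ /mapP[k + ->] ->]|[k [ltk nk ->]]].
  rewrite mem_filter mem_iota => /andP[nk ltk]; exists k; split=> //.
  by rewrite /lev path_levelS // (negPf nk).
exists (lev k); last by rewrite /lev path_levelS // (negPf nk).
by apply/mapP; exists k; rewrite // mem_filter nk mem_iota.
Qed.

Lemma north_levels_ge0 : all (fun nu => 0 <= nu)%R N.
Proof. by apply/allP => _ /north_levelP[k [/ltnW/dyck_level_ge0 ? _ ->]]. Qed.

Lemma east_end_levels_ge0 : all (fun mu => 0 <= mu)%R M.
Proof. by apply/allP => _ /east_end_levelP[k [/dyck_level_ge0 ? _ ->]]. Qed.

(** The truncated level takes the same value at both ends of the path, so only the
   counts of steps remain in the prefix inequality. *)
Lemma starts_below_slope (nu : int) :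
  a * count (fun e => e < nu)%R (east_levels a b P) <=
  b * count (fun n => n < nu)%R N.
Proof.
rewrite count_north_levels count_east_levels.
have := @starts_below_prefix a b P nu _ (leqnn _).
by rewrite [path_level _ _ _ _]dyck_level_size subrr subr_ge0 -!PoszM lez_nat.
Qed.

Lemma ends_below_slope (nu : int) :
  b * count (fun n => n + b%:Z < nu)%R N <=
  a * count (fun e => e - a%:Z < nu)%R (east_levels a b P).
Proof.
rewrite count_north_levels count_east_levels.
have := @ends_below_prefix a b P nu _ (leqnn _).
by rewrite [path_level _ _ _ _]dyck_level_size subrr subr_le0 -!PoszM lez_nat.
Qed.

Hypothesis (coprime_ab : coprime a b).

Lemma north_residue_system : residue_system a N.
Proof.
rewrite /residue_system size_north_levels eqxx -map_comp map_inj_in_uniq.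
  by rewrite filter_uniq ?iota_uniq.
move=> k k'; rewrite !mem_filter !mem_iota /= => /andP[nk ltk] /andP[nk' ltk'].
move=> /(level_mod_row coprime_ab); rewrite !north_step_row // => /(_ isT isT) eq_y.
have := ptyS ltk; have := ptyS ltk'; rewrite nk nk' /=.
by have := @pty_mono P k.+1 k'; have := @pty_mono P k'.+1 k; lia.
Qed.

Lemma east_residue_system : residue_system b M.
Proof.
rewrite /residue_system size_map size_east_levels eqxx -!map_comp.
rewrite map_inj_in_uniq; first by rewrite filter_uniq ?iota_uniq.
move=> k k'; rewrite !mem_filter !mem_iota /= => /andP[nk ltk] /andP[nk' ltk'].
have eqx := ptxS ltk; have eqx' := ptxS ltk'; rewrite nk /= addn1 in eqx.
rewrite nk' /= addn1 in eqx'.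
have sub_a x y : (level a b x y - a%:Z)%R = level a b x.+1 y.
  by rewrite /level; lia.
rewrite !sub_a => /(level_mod_column coprime_ab).
rewrite !east_step_column // => /(_ isT isT) eq_x.
by have := @ptx_mono P k.+1 k'; have := @ptx_mono P k'.+1 k; lia.
Qed.

Hypotheses (a_gt0 : 0 < a) (b_gt0 : 0 < b).

(** A Dyck path starts with a north step, since an east step would lead below
   level 0. *)
Lemma zero_north_level : 0%R \in N.
Proof.
apply/north_levelP; exists 0; rewrite dyck_size addn_gt0 a_gt0.
split=> //; last by rewrite /lev path_level0.
have lt0 : 0 < size P by rewrite dyck_size addn_gt0 a_gt0.
apply/negPn/negP => n0; have := dyck_level_ge0 lt0.
by rewrite /lev path_levelS // path_level0 (negPf n0); lia.
Qed.

(** A Dyck path ends with an east step, since a north step to level 0 would start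
   below level 0. *)
Lemma zero_east_end_level : 0%R \in M.
Proof.
apply/east_end_levelP; exists (size P).-1.
have lt0 : 0 < size P by rewrite dyck_size addn_gt0 a_gt0.
rewrite !prednK // leqnn dyck_level_size; split=> //.
apply/negP => nk; have := dyck_level_ge0 (leq_pred (size P)).
have := dyck_level_size; rewrite -{1}(prednK lt0) /lev path_levelS ?prednK //.
by rewrite nk; lia.
Qed.

Lemma positive_hooksP (h : nat) : reflect
  (exists c r, [/\ c < b, r < a, southeast_of P c r, 0 < h
    & Posz h = level a b c.+1 r]) (h \in positive_hooks a b P).
Proof.
apply: (iffP mapP) => [[[c r]]|[c [r [ltc ltr se h_gt0 eq_h]]]].
  rewrite mem_filter => /andP[/andP[/= se h_gt0] /allpairsP[[c' r'] /= [ltc ltr eq_cr]]].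
  case: eq_cr ltc ltr => <- <-; rewrite !mem_iota => ltc ltr ->.
  exists c, r; split=> //.
    by move: h_gt0; rewrite /hook_filling; lia.
  by move: h_gt0; rewrite /hook_filling; lia.
exists (c, r); last by rewrite /hook_filling /= -eq_h.
rewrite mem_filter /= se /hook_filling -eq_h ltz_nat h_gt0.
by apply/allpairsP; exists (c, r); rewrite /= !mem_iota ltc ltr.
Qed.

Lemma southeastP c r : reflect
  (exists k, [/\ k <= size P, ptx P k <= c & r < pty P k]) (southeast_of P c r).
Proof.
apply: (iffP hasP) => [[k]|[k [lek lex ley]]].
  by rewrite mem_iota ltnS => lek /andP[lex ley]; exists k.
by exists k; rewrite ?lex // mem_iota ltnS.
Qed.

(** In row r the boxes southeast of P are those to the right of the north step of
   that row, and their fillings are n - a, n - 2 a, ... where n is the level at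
   which this step starts. *)
Lemma positive_hooks_north (h : nat) :
  (h \in positive_hooks a b P) = ~~ gap a N h.
Proof.
apply/positive_hooksP/hasPn => [[c [r [ltc ltr /southeastP]]]|no_gap].
  move=> [k [lek lex ley]] h_gt0 eq_h _ /north_levelP[k' [ltk' nk' ->]].
  apply/negP => /andP[le_h /eqP]; rewrite eq_h => /(level_mod_row coprime_ab).
  rewrite north_step_row // ltr => /(_ isT isT) eq_r.
  have ltkk : k' < k by rewrite ltnNge; apply/negP => /(pty_mono P); lia.
  have := ptx_mono P (ltnW ltkk); move: le_h.
  by rewrite eq_h /lev /path_level eq_r /level; nia.
have [nu inN eq_nu] := residue_system_cover a_gt0 north_residue_system (Posz h).
have := no_gap nu inN; rewrite eq_nu eqxx andbT -ltNge => lt_h.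
have h_gt0 : 0 < h.
  have := no_gap _ zero_north_level; case: (h) => // /negP[].
  by rewrite lexx eqxx.
have /north_levelP[k [ltk nk eq_k]] := inN.
have /eqP := eq_nu; rewrite eqz_mod_dvd => /dvdzP[q eq_q].
have q_gt0 : (0 < q)%R by nia.
have ltr := north_step_row ltk nk.
rewrite eq_k /lev /path_level /level in eq_q.
exists (ptx P k + `|q|%N).-1, (pty P k); split=> //.
- have : a * (ptx P k + `|q|%N) < b * pty P k by lia.
  nia.
- apply/southeastP; exists k.+1; split=> //.
    by rewrite ptxS // nk /=; lia.
  by rewrite ptyS // nk /=; lia.
rewrite /level prednK; lia.
Qed.

(** In column c the boxes southeast of P are those below the east step of that
   column, and their fillings are m - b, m - 2 b, ... where m is the level at
   which this step ends. *)
Lemma positive_hooks_east (h : nat) :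
  (h \in positive_hooks a b P) = ~~ gap b M h.
Proof.
apply/positive_hooksP/hasPn => [[c [r [ltc ltr /southeastP]]]|no_gap].
  move=> [k [lek lex ley]] h_gt0 eq_h _ /east_end_levelP[k' [ltk' nk' ->]].
  have eqx := ptxS ltk'; have eqy := ptyS ltk'.
  rewrite (negPf nk') addn0 addn1 /= in eqx eqy.
  apply/negP => /andP[]; rewrite eq_h /lev /path_level eqx eqy.
  move=> le_h /eqP /(level_mod_column coprime_ab); rewrite east_step_column // ltc.
  move=> /(_ isT isT) eq_c.
  have lekk : k <= k' by rewrite leqNgt; apply/negP => /(ptx_mono P); lia.
  have := pty_mono P lekk; move: le_h.
  by rewrite eq_c /level; nia.
have [mu inM eq_mu] := residue_system_cover b_gt0 east_residue_system (Posz h).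
have := no_gap mu inM; rewrite eq_mu eqxx andbT -ltNge => lt_h.
have h_gt0 : 0 < h.
  have := no_gap _ zero_east_end_level; case: (h) => // /negP[].
  by rewrite lexx eqxx.
have /east_end_levelP[k [ltk nk eq_k]] := inM.
have eqx := ptxS ltk; have eqy := ptyS ltk.
rewrite (negPf nk) addn0 addn1 /= in eqx eqy.
have /eqP := eq_mu; rewrite eqz_mod_dvd => /dvdzP[q eq_q].
have q_gt0 : (0 < q)%R by nia.
have ltc := east_step_column ltk nk.
rewrite eq_k /lev /path_level /level eqx eqy in eq_q.
have lt_q : `|q|%N < pty P k.
  have : b * `|q|%N < b * pty P k by lia.
  by rewrite ltn_mul2l => /andP[].
have ley : pty P k <= a by rewrite -pty_size pty_mono // ltnW.
exists (ptx P k), (pty P k - `|q|%N); split=> //; first lia.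
- by apply/southeastP; exists k; split=> //; [exact: ltnW|lia].
rewrite /level; nia.
Qed.

Lemma lambda_levels : perm_eq (lambda a b P)
  [seq count (fun e => e < nu)%R (east_levels a b P) | nu <- N].
Proof.
have -> : [seq count (fun e => e < nu)%R (east_levels a b P) | nu <- N] =
    [seq count (fun mu => mu < nu - a%:Z)%R M | nu <- N].
  by apply: eq_map => nu; rewrite [RHS]count_map; apply: eq_count => e /=; lia.
apply: boundary_parts_gaps => //.
- exact: north_residue_system.
- exact: east_residue_system.
- exact: east_end_levels_ge0.
- by apply/allP => h /positive_hooksP[c [r []]].
- exact: positive_hooks_north.
- exact: positive_hooks_east.
Qed.

Lemma mu_levels : perm_eq (mu a b P)
  [seq count (fun nu => nu + b%:Z < e - a%:Z)%R N | e <- east_levels a b P].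
Proof.
have -> : [seq count (fun nu => nu + b%:Z < e - a%:Z)%R N
    | e <- east_levels a b P] = [seq count (fun nu => nu < mu - b%:Z)%R N | mu <- M].
  by rewrite -[RHS]map_comp; apply: eq_map => e /=; apply: eq_count => nu; lia.
apply: boundary_parts_gaps => //.
- exact: east_residue_system.
- exact: north_residue_system.
- exact: north_levels_ge0.
- by apply/allP => h /positive_hooksP[c [r []]].
- exact: positive_hooks_east.
- exact: positive_hooks_north.
Qed.

End DyckLevels.

(** * Sorted labels and shading *)

Lemma lt_count_nth_sort (s : seq int) (x : int) i : i < size s ->
  (i < count (fun e => e < x)%R s) = (nth 0 (sort <=%R s) i < x)%R.
Proof.
move=> lti; have /permP <- : perm_eq (sort <=%R s) s by rewrite perm_sort.
have ss : sorted <=%R (sort <=%R s) by apply: sort_le_sorted.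
have [ltc|gec] := ltnP; first by apply/esym/(nth_count_lt _ ss).
by apply/esym/negbTE; rewrite -leNgt; apply: (nth_count_ge _ ss); rewrite gec size_sort.
Qed.

Lemma count_lt_nth_sort (s : seq int) i : uniq s -> i < size s ->
  count (fun e => e < nth 0 (sort <=%R s) i)%R s = i.
Proof.
move=> us lti; have /permP <- : perm_eq (sort <=%R s) s by rewrite perm_sort.
by apply: count_lt_nth; rewrite ?size_sort // sort_lt_sorted.
Qed.

Lemma shadedP a b P c r :
  let n := nth 0%R (sort <=%R (north_levels a b P)) r in
  let e := nth 0%R (sort <=%R (east_levels a b P)) c in
  shaded a b P c r <-> ((e < n) || (n + b%:Z < e - a%:Z))%R.
Proof.
rewrite /shaded /row_label /column_label; set n := nth _ _ _; set e := nth _ _ _.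
move=> /=; split=> [disj|far [z]]; last by rewrite !in_itv /=; lia.
have [//|meet] := boolP (_ || _); case: disj.
(* Intervals that overlap share the larger of their left ends. *)
exists (Order.max n (e - a%:Z))%R; rewrite !in_itv /=.
by case: leP => /=; lia.
Qed.

Lemma southeast_of_rotate180 a b Q c r : lattice_path a b Q -> c < b -> r < a ->
  southeast_of (rotate180 Q) c r = northwest_of Q (b - c.+1) (a - r.+1).
Proof.
move=> /andP[/eqP cN /eqP cE] ltc ltr.
have count_rot p k : count p (take k (rotate180 Q)) =
    count p Q - count p (take (size Q - k) Q).
  rewrite take_rev count_rev.
  by rewrite -[in count p Q](cat_take_drop (size Q - k) Q) count_cat addKn.
have le_x k : ptx Q k <= b by rewrite -cE leq_count_subseq ?take_subseq.
have le_y k : pty Q k <= a by rewrite -cN leq_count_subseq ?take_subseq.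
have ptx_rot k : ptx (rotate180 Q) k = b - ptx Q (size Q - k).
  by rewrite /ptx count_rot cE.
have pty_rot k : pty (rotate180 Q) k = a - pty Q (size Q - k).
  by rewrite /pty count_rot cN.
have szR : size (rotate180 Q) = size Q := size_rev Q.
apply/hasP/hasP => -[k]; rewrite mem_iota => lek.
  rewrite ptx_rot pty_rot => near; exists (size Q - k); first by rewrite mem_iota; lia.
  by have := le_x (size Q - k); have := le_y (size Q - k); lia.
move=> near; exists (size Q - k); first by rewrite mem_iota szR; lia.
rewrite ptx_rot pty_rot subKn; last lia.
by have := le_x k; have := le_y k; lia.
Qed.

Theorem theorem5p18 (a b : nat) (a_gt0 : 0 < a) (b_gt0 : 0 < b)
    (coprime_ab : coprime a b) (P : seq bool) (dyckP : dyck_path a b P) :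
  bounds_from_northwest a b
    (fun c r => shaded a b P c r /\ above_diagonal a b c r) (zeta a b P) /\
  bounds_from_southeast a b
    (fun c r => shaded a b P c r /\ below_diagonal a b c r)
    (rotate180 (eta a b P)).
Proof.
set E := east_levels a b P; set N := north_levels a b P.
have szN : size N = a := size_north_levels dyckP.
have szE : size E = b := size_east_levels dyckP.
have uN : uniq N.
  by have /andP[_ /map_uniq] := north_residue_system dyckP coprime_ab.
have uE : uniq E.
  by have /andP[_ /map_uniq/map_uniq] := east_residue_system dyckP coprime_ab.
have permL := lambda_levels dyckP coprime_ab a_gt0 b_gt0.
have permM := mu_levels dyckP coprime_ab a_gt0 b_gt0.
have szL : size (lambda a b P) = a by rewrite (perm_size permL) size_map.
have szM : size (mu a b P) = b by rewrite (perm_size permM) size_map.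
pose n r := nth 0%R (sort <=%R N) r; pose e c := nth 0%R (sort <=%R E) c.
have below_left c r : c < b -> r < a -> (e c < n r)%R -> a * c.+1 <= b * r.
  move=> ltc ltr; rewrite -lt_count_nth_sort ?szE // => lt_count.
  apply: leq_trans (_ : a * count (fun x => x < n r)%R E <= _).
    by rewrite leq_mul2l lt_count orbT.
  apply: leq_trans (starts_below_slope dyckP _) _.
  by rewrite count_lt_nth_sort ?szN.
have lt_count_north r x : r < a ->
    (r < count (fun nu => nu + b%:Z < x - a%:Z)%R N) = (n r + b%:Z < x - a%:Z)%R.
  move=> ltr; rewrite (eq_count (_ : _ =1 fun nu => nu < x - a%:Z - b%:Z)%R).
    by rewrite lt_count_nth_sort ?szN // -/(n r); lia.
  by move=> nu /=; lia.
have below_right c r : c < b -> r < a -> (n r + b%:Z < e c - a%:Z)%R ->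
    b * r.+1 <= a * c.
  move=> ltc ltr; rewrite -lt_count_north // => lt_count.
  apply: leq_trans (_ : b * count (fun x => x + b%:Z < e c - a%:Z)%R N <= _).
    by rewrite leq_mul2l lt_count orbT.
  apply: leq_trans (ends_below_slope dyckP _) _.
  rewrite (eq_count (_ : _ =1 fun x => x < e c)%R); last by move=> x /=; lia.
  by rewrite count_lt_nth_sort ?szE.
split.
  have eqL : lambda a b P = rev [seq count (fun x => x < nu)%R E | nu <- sort <=%R N].
    apply: (sorted_eq geq_trans).
    - by move=> x y /=; lia.
    - exact: sorted_boundary_parts.
    - rewrite rev_sorted; apply: homo_sorted (sort_le_sorted N) => x y /= lexy.
      by apply: sub_count => z /=; lia.
    - rewrite (permPl permL) perm_sym perm_rev perm_map //.
      by rewrite perm_sort.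
  have sL := sorted_boundary_parts a b (core a b P).
  have leL : all (fun p => p <= b) (lambda a b P).
    rewrite (perm_all _ permL) all_map; apply/allP => x _ /=.
    by rewrite -[X in _ <= X]szE count_size.
  have [pathZ nwZ] := northwest_of_bounding_path sL leL.
  rewrite -/(lambda a b P) szL in pathZ nwZ.
  split=> // c r ltc ltr; rewrite nwZ // eqL nth_rev ?size_map ?size_sort ?szN; last lia.
  have -> : a - (a - r.+1).+1 = r by lia.
  rewrite (nth_map 0%R) ?size_sort ?szN // lt_count_nth_sort ?szE //.
  rewrite -/(e c) -/(n r) shadedP -/N -/E -/(e c) -/(n r) /above_diagonal /level.
  have := below_left c r ltc ltr; have := below_right c r ltc ltr.
  case: ltP => /=; case: ltP => /=; lia.
have sM : sorted geq [seq conj_part (mu a b P) j | j <- iota 0 a].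
  apply: homo_sorted (iota_sorted 0 a) => i j lej.
  by apply: sub_count => p /=; lia.
have leM : all (fun p => p <= b) [seq conj_part (mu a b P) j | j <- iota 0 a].
  by rewrite all_map; apply/allP => j _ /=; rewrite -[X in _ <= X]szM count_size.
have [pathE nwE] := northwest_of_bounding_path sM leM.
rewrite size_map size_iota -/(eta a b P) in pathE nwE.
split.
  by have := pathE; rewrite /lattice_path !count_rev.
move=> c r ltc ltr; rewrite (southeast_of_rotate180 pathE) // nwE; [|lia..].
have -> : a - (a - r.+1).+1 = r by lia.
rewrite (nth_map 0) ?size_iota // nth_iota // add0n /conj_part (permP permM).
rewrite count_map.
(* As mu lists its parts in decreasing order, the rotation matches its columns
   with the sorted east levels counted from the right. *)
rewrite (eq_count (_ : _ =1 predC (fun x => x < n r + b%:Z + a%:Z + 1)%R)); last first.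
  by move=> x /=; rewrite lt_count_north //; lia.
have := count_predC (fun x => x < n r + b%:Z + a%:Z + 1)%R E; rewrite szE.
have := lt_count_nth_sort (n r + b%:Z + a%:Z + 1)%R (i := c) (s := E).
rewrite szE -/(e c) => /(_ ltc).
rewrite shadedP -/N -/E -/(e c) -/(n r) /below_diagonal /level.
have := below_left c r ltc ltr; have := below_right c r ltc ltr.
move: (count _ E) (count _ E) => less more; lia.
Qed.
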